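(* Let $\Gamma$ be a nonempty set and let $\mathcal{S}$ be a countably intersected family of subsets of $\Gamma$. Then the Banach space $J\mathcal{S}$ does not contain a subspace isomorphic to $\ell^{1}(\mathbb{N})$.
   Context: A family $\mathcal{S}$ of subsets of $\Gamma$ is countably intersected (C.I.) if: (a) $\mathcal{S}$ consists of countable subsets of $\Gamma$, contains all singletons, and is pointwise closed, i.e. $\{\chi_s : s\in\mathcal{S}\}$ is closed in $\{0,1\}^{\Gamma}$ with the product topology; (b) for all $s,t\in\mathcal{S}$, the set $s\setminus t$ is a finite union of pairwise disjoint elements of $\mathcal{S}$; (c) to every $t\in\mathcal{S}$ one can assign $s_t\in\mathcal{S}$ with $t\subseteq s_t$ such that for all $s,t_1,\dots,t_n\in\mathcal{S}$ there exists $t\in\mathcal{S}$ with $t\subseteq s\setminus\bigcup_{i=1}^n s_{t_i}$ and $s\setminus\big(\bigcup_{i=1}^n s_{t_i}\cup t\big)$ finite; (d) for every $s\in\mathcal{S}$ the set $\{s\cap t: t\in\mathcal{S}\}$ is countable. For a family $\mathcal{S}$ of subsets of $\Gamma$ and a finitely supported function $\phi:\Gamma\to\mathbb{R}$, the James-$\mathcal{S}$ norm is $\|\phi\|=\sup\big(\sum_{i=1}^n(\sum_{a\in s_i}\phi(a))^2\big)^{1/2}$, the supremum over all finite families $\{s_1,\dots,s_n\}$ of pairwise disjoint elements of $\mathcal{S}$. $J\mathcal{S}$ denotes the completion of the space of finitely supported real functions on $\Gamma$ in this norm. *)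

(* Defs.v *)
From mathcomp Require Import all_boot all_order all_algebra.
From mathcomp Require Import all_classical all_reals all_analysis.
Set Implicit Arguments. Unset Strict Implicit. Unset Printing Implicit Defensive.
Import Order.TTheory GRing.Theory Num.Theory.
Import numFieldNormedType.Exports.
Local Open Scope classical_set_scope.
Local Open Scope ring_scope.

Section CIDefs.
Context {G : choiceType}.

Definition family_in (S : set (set G)) (n : nat) (f : nat -> set G) : Prop :=
  forall k, (k < n)%N -> S (f k).

Definition pw_disjoint (n : nat) (f : nat -> set G) : Prop :=
  forall i j, (i < n)%N -> (j < n)%N -> i <> j -> f i `&` f j = set0.

Definition union_fam (n : nat) (f : nat -> set G) : set G :=
  \bigcup_(k in `I_n) f k.

Definition pointwise_closed (S : set (set G)) : Prop :=
  closed ([set (fun a => `[< s a >]) | s in S] : set {ptws G -> bool}).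

Definition countably_intersected (S : set (set G)) : Prop :=
  [/\
      [/\ (forall s, S s -> countable s), (forall a, S [set a]) & pointwise_closed S],
      (forall s t, S s -> S t -> exists n f,
          [/\ family_in S n f, pw_disjoint n f & s `\` t = union_fam n f]),
      (exists sig : set G -> set G,
          (forall t, S t -> S (sig t) /\ t `<=` sig t) /\
          (forall s n (ts : nat -> set G), (0 < n)%N -> S s -> family_in S n ts ->
             exists t, [/\ S t,
               t `<=` s `\` union_fam n (sig \o ts) &
               finite_set (s `\` (union_fam n (sig \o ts) `|` t))]))
    &
      (forall s, S s -> countable [set s `&` t | t in S]) ].

Context {R : realType}.

Definition fin_supp (phi : G -> R) : Prop := finite_set [set a | phi a != 0].

(** sum_{a in s} phi(a) (finite for finitely supported phi). *)
Definition ssum (phi : G -> R) (s : set G) : R := \sum_(a \in s) phi a.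

Definition jvals (S : set (set G)) (phi : G -> R) : set R :=
  [set r | exists n f, [/\ family_in S n f, pw_disjoint n f &
                          r = \sum_(k < n) (ssum phi (f k)) ^+ 2]].

Definition jnorm (S : set (set G)) (phi : G -> R) : R := Num.sqrt (sup (jvals S phi)).

(** Elements of the completion JS, represented by Cauchy sequences
    (for the James-S norm) of finitely supported functions. *)
Definition JS_elem (S : set (set G)) (u : nat -> G -> R) : Prop :=
  (forall n, fin_supp (u n)) /\
  (forall e : R, 0 < e -> exists N, forall m n, (N <= m)%N -> (N <= n)%N ->
      jnorm S (u m \- u n) < e).

Definition JS_equiv (S : set (set G)) (u v : nat -> G -> R) : Prop :=
  (fun n => jnorm S (u n \- v n)) @ \oo --> (0 : R).

Definition JS_norm (S : set (set G)) (u : nat -> G -> R) : R :=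
  limn (fun n => jnorm S (u n)).

End CIDefs.

Definition l1 {R : realType} (a : nat -> R) : Prop :=
  cvgn (series (fun k => `|a k|)).
Definition l1norm {R : realType} (a : nat -> R) : R :=
  limn (series (fun k => `|a k|)).

(* Main.v *)
Require Import Defs.
From mathcomp Require Import all_boot all_order all_algebra.
From mathcomp Require Import all_classical all_reals all_analysis.
From mathcomp Require Import finmap lra ring zify.
Import Order.TTheory GRing.Theory Num.Theory.
Import numFieldNormedType.Exports.
Local Open Scope classical_set_scope.
Local Open Scope ring_scope.

(** Given a bounded sequence of finitely supported functions and e > 0, some
    subsequence has the sums over every fixed s in S oscillating by at most e.
    Otherwise, axioms (c) and (d) produce successive disjoint t_1, ..., t_k in
    S whose sums all exceed e/4 in modulus along one further subsequence, which
    contradicts boundedness for large k: by (d) one can first make the sums over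
    the countably many traces of S on the union of the s_(t_i) converge, so
    that an oscillating s may by (c) be replaced by a t disjoint from them.

    Differences of consecutive terms then have small sums over each s
    eventually, and since S is compact a Mazur type argument gives convex blocks
    whose sums are small uniformly over S. Each s missing the support of w sees
    only z in w + z, and few disjoint s meet it, so if z is uniformly small
    enough then ||w + z||^2 <= ||w||^2 + ||z||^2 + 1. Hence k successive blocks
    of l^1 weight 1 can be chosen whose sum has norm O(sqrt k), while an
    isomorphic copy of l^1 forces norm at least c k. *)

(** * Sums of finitely supported functions over sets *)

Section FiniteSums.
Context {G : choiceType} {R : realType}.
Implicit Types (phi psi : G -> R) (s t : set G).

Lemma fin_suppP phi :
  fin_supp phi <-> exists A : {fset G}, forall a, a \notin A -> phi a = 0.
Proof.
split=> [fphi|[A A0]].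
  exists (fset_set [set a | phi a != 0]) => a.
  rewrite in_fset_set// notin_setE /= => /negP; rewrite negbK => /eqP //.
apply: (@sub_finite_set _ _ [set` A]) => [a /= pa|]; last exact: finite_fset.
by apply: contraNT pa => /A0 ->.
Qed.

Lemma ssumE {phi} {A : {fset G}} s : (forall a, a \notin A -> phi a = 0) ->
  ssum phi s = \sum_(a <- A) phi a * (a \in s)%:R.
Proof.
move=> A0; rewrite /ssum fsbig_mkcond (@fsbigTE _ _ _ _ A).
  apply: eq_bigr => a _; rewrite /patch.
  by case: ifP => _; rewrite ?mulr1 ?mulr0.
by move=> a aA; rewrite /patch A0// if_same.
Qed.

Lemma combE phi psi (x y : R) a :
  (x *: phi + y *: psi) a = x * phi a + y * psi a.
Proof. by []. Qed.

Lemma fin_supp_comb {phi psi} (x y : R) : fin_supp phi -> fin_supp psi ->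
  fin_supp (x *: phi + y *: psi).
Proof.
move=> /fin_suppP[A A0] /fin_suppP[B B0]; apply/fin_suppP.
exists (A `|` B)%fset => a; rewrite in_fsetU negb_or => /andP[aA aB].
by rewrite combE A0// B0// !mulr0 addr0.
Qed.

Lemma ssum_comb {phi psi} (x y : R) s : fin_supp phi -> fin_supp psi ->
  ssum (x *: phi + y *: psi) s = x * ssum phi s + y * ssum psi s.
Proof.
move=> /fin_suppP[A A0] /fin_suppP[B B0].
have A0' a : a \notin (A `|` B)%fset -> phi a = 0.
  by rewrite in_fsetU negb_or => /andP[/A0].
have B0' a : a \notin (A `|` B)%fset -> psi a = 0.
  by rewrite in_fsetU negb_or => /andP[_ /B0].
rewrite (ssumE _ A0') (ssumE _ B0') (@ssumE _ (A `|` B)%fset); last first.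
  by move=> a aAB; rewrite combE A0'// B0'// !mulr0 addr0.
rewrite !mulr_sumr -big_split /=; apply: eq_bigr => a _.
by rewrite combE; ring.
Qed.

Lemma ssumU {phi} s t : fin_supp phi -> s `&` t = set0 ->
  ssum phi (s `|` t) = ssum phi s + ssum phi t.
Proof.
move=> /fin_suppP[A A0] st0; rewrite !(ssumE _ A0) -big_split /=.
apply: eq_bigr => a _; rewrite in_setU -mulrDr -natrD.
have [sa|_] := boolP (a \in s); have [ta|_] := boolP (a \in t); rewrite ?addn0//=.
by have : (s `&` t) a by [split; exact: set_mem]; rewrite st0.
Qed.

Lemma ssum1 {phi} a : ssum phi [set a] = phi a.
Proof. by rewrite /ssum fsbig_set1. Qed.

Lemma hits_le1 n (f : nat -> set G) a : pw_disjoint n f ->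
  \sum_(k < n) (a \in f k)%:R <= 1 :> R.
Proof.
move=> fd; have [[k ak]|ha] := pselect (exists k : 'I_n, a \in f k).
  rewrite (bigD1 k) //= ak big1 ?addr0// => j jk.
  case: (boolP (a \in f j)) => // aj.
  have : (f j `&` f k) a by split; exact: set_mem.
  by rewrite fd// => /val_inj jk'; rewrite jk' eqxx in jk.
rewrite big1// => k _; case: (boolP (a \in f k)) => // ak.
by case: ha; exists k.
Qed.

(** Double counting: a point of [A] lies in at most one of the disjoint sets. Combined with
    [ssum_hit], this bounds the number of sets on which a function supported in [A] has nonzero
    sum. *)
Lemma hits_le_card n (f : nat -> set G) (A : {fset G}) : pw_disjoint n f ->
  \sum_(k < n) \sum_(a <- A) (a \in f k)%:R <= (size A)%:R :> R.
Proof.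
move=> fd; rewrite exchange_big /= -sum1_size natr_sum.
by apply: ler_sum => a _; exact: hits_le1.
Qed.

Lemma ssum_hit {phi} {A : {fset G}} s : (forall a, a \notin A -> phi a = 0) ->
  ssum phi s != 0 -> 1 <= \sum_(a <- A) (a \in s)%:R :> R.
Proof.
move=> A0; rewrite (ssumE s A0); apply: contraNT.
move=> h; rewrite big_seq big1// => a aA.
case: (boolP (a \in s)) => as_; last by rewrite mulr0.
exfalso; move/negP: h; apply.
rewrite (big_rem a) //= as_ lerDl sumr_ge0// => b _.
Qed.

Lemma ssum_le_l1 {phi} {A : {fset G}} s : (forall a, a \notin A -> phi a = 0) ->
  `|ssum phi s| <= \sum_(a <- A) `|phi a|.
Proof.
move=> A0; rewrite (ssumE _ A0); apply: (le_trans (ler_norm_sum _ _ _)).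
apply: ler_sum => a _; rewrite normrM ler_piMr//.
by case: (a \in s); rewrite ?normr1 ?normr0.
Qed.

End FiniteSums.

(** * The James norm: finiteness and subadditivity *)

Section JamesNorm.
Context {G : choiceType} {R : realType} (S : set (set G)).
Implicit Types (phi psi : G -> R) (s t : set G).

Lemma jvals0 phi : jvals S phi 0.
Proof. by exists 0%N, (fun=> set0); split=> //; rewrite big_ord0. Qed.

(** Every nonzero term is at most the squared l^1 norm of [phi] and is charged to a point of the
    support, so there are at most [size A] of them. This keeps [sup] in [jnorm] from being a default
    value. *)
Lemma has_sup_jvals {phi} : fin_supp phi -> has_sup (jvals S phi).
Proof.
move=> /fin_suppP[A A0]; split; first by exists 0; exact: jvals0.
exists ((\sum_(a <- A) `|phi a|) ^+ 2 * (size A)%:R) => _ [n [f [_ fd ->]]].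
apply: (le_trans _ (ler_wpM2l (sqr_ge0 (\sum_(a <- A) `|phi a|))
  (@hits_le_card _ R n f A fd))).
rewrite mulr_sumr; apply: ler_sum => k _.
have [->|n0] := eqVneq (ssum phi (f k)) 0.
  by rewrite expr0n/= mulr_ge0 ?sqr_ge0// sumr_ge0.
apply: (@le_trans _ _ ((\sum_(a <- A) `|phi a|) ^+ 2)).
  rewrite -real_normK ?num_real// lerXn2r ?nnegrE ?sumr_ge0//.
  exact: ssum_le_l1.
by rewrite ler_peMr ?sqr_ge0//; exact: (ssum_hit _ A0).
Qed.

Lemma jnorm_ge0 phi : 0 <= jnorm S phi.
Proof. exact: sqrtr_ge0. Qed.

Lemma sum_ssum_le {phi} {n f} : fin_supp phi -> family_in S n f ->
  pw_disjoint n f -> \sum_(k < n) (ssum phi (f k)) ^+ 2 <= jnorm S phi ^+ 2.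
Proof.
move=> fphi fS fd; have hs := has_sup_jvals fphi.
rewrite sqr_sqrtr; last by apply: (sup_upper_bound hs); exact: jvals0.
by apply: (sup_upper_bound hs); exists n, f.
Qed.

Lemma jnorm_le phi (x : R) : 0 <= x ->
  (forall n f, family_in S n f -> pw_disjoint n f ->
    \sum_(k < n) (ssum phi (f k)) ^+ 2 <= x ^+ 2) -> jnorm S phi <= x.
Proof.
move=> x0 h; rewrite -(ger0_norm x0) -sqrtr_sqr /jnorm ler_wsqrtr//.
apply: ge_sup; first by exists 0; exact: jvals0.
by move=> _ [n [f [fS fd ->]]]; exact: h.
Qed.

Lemma ssum_le_jnorm {phi} s : fin_supp phi -> S s -> `|ssum phi s| <= jnorm S phi.
Proof.
move=> fphi Ss; rewrite -(@ler_pXn2r _ 2) ?nnegrE ?jnorm_ge0//.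
rewrite real_normK ?num_real//.
have := @sum_ssum_le phi 1 (fun=> s) fphi.
rewrite big_ord1; apply; first by [].
by move=> [|i] [|j].
Qed.

Lemma jnorm_comb {phi psi} (x y : R) : fin_supp phi -> fin_supp psi ->
  jnorm S (x *: phi + y *: psi) <= `|x| * jnorm S phi + `|y| * jnorm S psi.
Proof.
move=> fphi fpsi; apply/ler_addgt0Pl => e e0.
(* The slack [e / 2] makes [p] and [q] positive, so that both may serve as denominators in the
   weights below. *)
pose p := `|x| * jnorm S phi + e / 2; pose q := `|y| * jnorm S psi + e / 2.
have p0 : 0 < p by rewrite ltr_wpDl ?mulr_ge0 ?jnorm_ge0 ?divr_gt0.
have q0 : 0 < q by rewrite ltr_wpDl ?mulr_ge0 ?jnorm_ge0 ?divr_gt0.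
have -> : e + (`|x| * jnorm S phi + `|y| * jnorm S psi) = p + q.
  by rewrite /p /q; field.
apply: jnorm_le; first by rewrite addr_ge0 ?ltW.
move=> n f fS fd.
have aux (z : R) theta r : fin_supp theta -> `|z| * jnorm S theta < r ->
    \sum_(k < n) (z * ssum theta (f k)) ^+ 2 <= r ^+ 2.
  move=> ft hr; under eq_bigr do rewrite exprMn.
  rewrite -mulr_sumr; apply: (le_trans (ler_wpM2l (sqr_ge0 z) (sum_ssum_le ft fS fd))).
  rewrite -exprMn -real_normK ?num_real// normrM (ger0_norm (jnorm_ge0 _)).
  by rewrite lerXn2r ?nnegrE ?mulr_ge0 ?jnorm_ge0// ltW// (le_lt_trans _ hr) ?mulr_ge0 ?jnorm_ge0.
have hp : \sum_(k < n) (x * ssum phi (f k)) ^+ 2 <= p ^+ 2.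
  by apply: aux => //; rewrite ltrDl divr_gt0.
have hq : \sum_(k < n) (y * ssum psi (f k)) ^+ 2 <= q ^+ 2.
  by apply: aux => //; rewrite ltrDl divr_gt0.
(* weighted AM-GM: [(u + v)^2 <= (1 + q / p) u^2 + (1 + p / q) v^2] *)
apply: (@le_trans _ _ ((1 + q / p) * \sum_(k < n) (x * ssum phi (f k)) ^+ 2
   + (1 + p / q) * \sum_(k < n) (y * ssum psi (f k)) ^+ 2)).
  rewrite !mulr_sumr -big_split /=; apply: ler_sum => k _.
  rewrite ssum_comb//; set u := x * _; set v := y * _.
  rewrite -subr_ge0.
  have -> : (1 + q / p) * u ^+ 2 + (1 + p / q) * v ^+ 2 - (u + v) ^+ 2
     = (q * u - p * v) ^+ 2 / (p * q).
    by field; rewrite (gt_eqF p0) (gt_eqF q0).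
  by rewrite divr_ge0 ?sqr_ge0// mulr_ge0 ?ltW.
have -> : (p + q) ^+ 2 = (1 + q / p) * p ^+ 2 + (1 + p / q) * q ^+ 2.
  by field; rewrite (gt_eqF p0) (gt_eqF q0).
by apply: lerD; apply: ler_wpM2l => //; rewrite addr_ge0// divr_ge0// ltW.
Qed.

End JamesNorm.

(** * Subsequences along which countably many bounded sequences converge *)

Section Subsequences.
Context {R : realType}.

Definition unbounded_set (L : set nat) := forall m, exists2 n, (m <= n)%N & L n.

Definition osc_le (L : set nat) (u : nat -> R) (e : R) := exists N, forall m n,
  (N <= m)%N -> (N <= n)%N -> L m -> L n -> `|u m - u n| <= e.

Lemma ultrafilter_of_unbounded {L : set nat} : unbounded_set L ->
  exists U : set_system nat,
    [/\ UltraFilter U, U L & forall m, U [set n | (m <= n)%N]].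
Proof.
move=> uL; pose F := filter_from setT (fun m => [set n | (m <= n)%N /\ L n]).
have FF : ProperFilter F.
  apply: filter_from_proper; last by move=> m _; have [n mn Ln] := uL m; exists n.
  apply: filter_fromT_filter; first by exists 0%N.
  move=> i j; exists (maxn i j) => n /= [ijn Ln]; split; split=> //;
    by apply: leq_trans ijn; rewrite ?leq_maxl ?leq_maxr.
have [U [UU FU]] := @ultraFilterLemma _ F FF.
exists U; split=> //.
  by apply: FU; exists 0%N => // n [].
by move=> m; apply: FU; exists m => // n [].
Qed.

Lemma ultrafilter_bounded_lim {T : Type} {U : set_system T} {UU : UltraFilter U}
    {g : T -> R} {b : R} : (forall n, `|g n| <= b) ->
  exists l : R, forall e : R, 0 < e -> U [set n | `|g n - l| < e].
Proof.
move=> gb.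
have [|l [_ gl]] := @segment_compact R (- b) b (g @ U) _.
  by apply: nearW => n /=; rewrite in_itv /= -ler_norml.
exists l => e e0; have [//|h] := in_ultra_setVsetC [set n | `|g n - l| < e] UU.
have [x [/= ex xe]] := gl (~` [set x | `|x - l| < e]) (ball l e) h (nbhsx_ballx l e e0).
by exfalso; apply: ex; rewrite distrC.
Qed.

(** Limits along one ultrafilter replace the successive extractions: the k-th index is chosen in [L]
    so that the sequences numbered up to k are within 1/(k+1) of their limits. *)
Lemma diagonal_subsequence {I : Type} (A : set I) (v : I -> nat -> R)
    {L : set nat} : countable A -> (forall i, A i -> exists b : R, forall n, `|v i n| <= b) ->
  unbounded_set L ->
  exists L', [/\ L' `<=` L, unbounded_set L' &
    forall i (e : R), A i -> 0 < e -> osc_le L' (v i) e].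
Proof.
move=> /countable_injP[f finj] vb uL.
have [U [UU UL Utail]] := ultrafilter_of_unbounded uL.
have /choice[l hl] : forall i, exists l : R, A i ->
    forall e : R, 0 < e -> U [set n | `|v i n - l| < e].
  move=> i; have [Ai|nAi] := pselect (A i); last by exists 0.
  have [b vib] := vb i Ai.
  by have [l hl] := ultrafilter_bounded_lim vib; exists l.
pose good k n := forall i, A i -> (f i <= k)%N -> `|v i n - l i| < k.+1%:R^-1.
have Ugood k : U [set n | good k n].
  (* Since [f] is injective on [A], each [j] concerns at most one [i], so only finitely many members
     of [U] are intersected. *)
  have : U [set n | forall j : 'I_k.+1, forall i, A i -> f i = j -> `|v i n - l i| < k.+1%:R^-1].
    apply: filter_forall => j.
    have [[i [Ai fij]]|h] := pselect (exists i, A i /\ f i = j); last first.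
      by apply: nearW => n i Ai fij; case: h; exists i.
    have := hl i Ai k.+1%:R^-1; rewrite invr_gt0 ltr0n => /(_ isT); apply: filterS.
    move=> n /= ? i' Ai' fi'; suff -> : i' = i by [].
    by apply: finj; [exact: mem_set|exact: mem_set|rewrite fi' fij].
  apply: filterS => n /= h i Ai fik.
  exact: (h (Ordinal (fik : (f i < k.+1)%N))).
have /choice[h hh] : forall k, exists n, [/\ L n, (k <= n)%N & good k n].
  move=> k; have [n [[/= Ln kn] gn]] := filter_ex (filterI (filterI UL (Utail k)) (Ugood k)).
  by exists n.
exists (range h); split.
- by move=> _ [k _ <-]; have [Lh _ _] := hh k.
- by move=> m; have [Lh mh _] := hh m; exists (h m) => //; exists m.
- move=> i e Ai e0.
  have [K hK] : exists K : nat, K.+1%:R^-1 < e / 2.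
    have := @near_infty_natSinv_lt R (PosNum (divr_gt0 e0 (ltr0n _ 2))).
    by move=> [K _ hK]; exists K; exact: (hK K (leqnn K)).
  pose M := maxn K (f i).
  (* [h] need not be monotone, but a value above all [h k] with [k < M] can only be some [h r] with
     [M <= r]. *)
  exists (\max_(k < M) (h k)).+1 => m n Nm Nn [p _ hp] [q _ hq].
  have aux r x : (\max_(k < M) (h k) < x)%N -> h r = x -> `|v i x - l i| < e / 2.
    move=> Nx hr; have Mr : (M <= r)%N.
      rewrite leqNgt; apply/negP => rM.
      by have := @leq_bigmax 'I_M (fun k => h k) (Ordinal rM); rewrite /= hr leqNgt Nx.
    have [_ _ gr] := hh r; rewrite hr in gr.
    apply: lt_trans (gr i Ai (leq_trans (leq_maxr _ _) Mr)) (le_lt_trans _ hK).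
    by rewrite lef_pV2 ?posrE ?ltr0n// ler_nat ltnS (leq_trans _ Mr)// leq_maxl.
  have hm := aux p m Nm hp; have hn := aux q n Nn hq.
  by move: hm hn; rewrite !ltr_norml ler_norml; lra.
Qed.

End Subsequences.

(** * Compactness of a pointwise closed family *)

Section ClusterPoint.
Context {G : choiceType} {R : realType} (S : set (set G)).

(** The limit of [s] along an ultrafilter containing all tails belongs to [S] by closedness. A
    finitely supported function sees only finitely many coordinates, and on these [s k] agrees with
    the limit for arbitrarily large [k]. *)
Lemma pointwise_closed_cluster (s : nat -> set G) : pointwise_closed S ->
  (forall k, S (s k)) ->
  exists2 t, S t & forall phi : G -> R, fin_supp phi ->
    forall m, exists2 k, (m <= k)%N & ssum phi (s k) = ssum phi t.
Proof.
move=> Scl Ss.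
have [U [UU _ Utail]] := @ultrafilter_of_unbounded setT (fun m => ex_intro2 _ _ m (leqnn m) I).
pose t : set G := [set a | U [set k | s k a]].
have Ut a : U [set k | s k a <-> t a].
  have [sa|sa] := in_ultra_setVsetC [set k | s k a] UU.
    by apply: (filterS _ sa) => k /= ska; split.
  apply: (filterS _ sa) => k /= nska; split=> // ta; exfalso.
  by have [j [/= sja nsja]] := filter_ex (filterI ta sa); exact: nsja.
have St : [set (fun a => `[< s0 a >]) | s0 in S] (fun a => `[< t a >]).
  have := @closed_cvg _ {ptws G -> bool} U _ (fun k => (fun a => `[< s k a >])) _ Scl.
  apply.
    by apply: nearW => k; exists (s k).
  (* Convergence in the product topology is checked coordinatewise, where it means eventual equality
     because [bool] is discrete. *)
  apply/cvg_sup => a; apply/cvg_image.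
    by apply/seteqP; split=> // b _; exists (fun=> b).
  move=> W /= /principal_filterP Wta; exists [set g : G -> bool | W (g a)].
    have : U [set k | W `[< s k a >]]; last by [].
    apply: (filterS _ (Ut a)) => k /= [st ts].
    suff -> : `[< s k a >] = `[< t a >] by [].
    by apply/asbool_equiv_eq; split.
  by apply/seteqP; split=> [_ [g Wg <-]//|b Wb]; exists (fun=> b).
exists t.
  have [s0 Ss0 /funeqP s0t] := St.
  suff -> : t = s0 by [].
  apply/funext => a; have e : `[< s0 a >] = `[< t a >] := s0t a.
  by apply/propext; split=> h; apply/asboolP; [rewrite e|rewrite -e]; exact/asboolP.
move=> phi /fin_suppP[A A0] m.
have : U [set k | forall a : A, s k (val a) <-> t (val a)].
  by apply: filter_forall => a; exact: Ut.
move=> /(filterI (Utail m)) h; have [k [/= mk hk]] := filter_ex h.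
exists k => //; rewrite !(ssumE _ A0) big_seq [RHS]big_seq; apply: eq_bigr => a aA.
congr (_ * (nat_of_bool _)%:R); apply/idP/idP => /set_mem h';
  by apply/mem_set; exact/(hk [` aA]%fset).
Qed.

End ClusterPoint.

(** * Extraction of a subsequence oscillating little on every member of [S] *)

Section Oscillation.
Context {G : choiceType} {R : realType}.

Lemma osc_leD {L : set nat} {u v : nat -> R} {x y : R} :
  osc_le L u x -> osc_le L v y -> osc_le L (fun n => u n + v n) (x + y).
Proof.
move=> [N hN] [N' hN']; exists (maxn N N') => m n; rewrite !geq_max.
move=> /andP[Nm N'm] /andP[Nn N'n] Lm Ln.
have := hN m n Nm Nn Lm Ln; have := hN' m n N'm N'n Lm Ln.
by rewrite !ler_norml; lra.
Qed.

Lemma osc_le_sum {L : set nat} {I : Type} (r : seq I) (u : I -> nat -> R) :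
  (forall i (e : R), 0 < e -> osc_le L (u i) e) ->
  forall e, 0 < e -> osc_le L (fun n => \sum_(i <- r) u i n) e.
Proof.
move=> hu; elim: r => [|i r IH] e e0.
  by exists 0%N => m n _ _ _ _; rewrite !big_nil subrr normr0 ltW.
have e20 : 0 < e / 2 by rewrite divr_gt0.
have := osc_leD (hu i _ e20) (IH _ e20).
rewrite -splitr => -[N hN]; exists N => m n Nm Nn Lm Ln.
by rewrite !big_cons; exact: hN.
Qed.

Lemma osc_le_finite {L : set nat} {phi : nat -> G -> R} {F : set G} :
  finite_set F ->
  (forall a (e : R), 0 < e -> osc_le L (fun n => phi n a) e) ->
  forall e, 0 < e -> osc_le L (fun n => ssum (phi n) F) e.
Proof.
move=> fF hphi e e0.
have [N hN] := osc_le_sum (fset_set F) (fun a n => phi n a) hphi e e0.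
by exists N => m n; rewrite /ssum !fsbig_finite//; exact: hN.
Qed.

(** A trace on the union is the union of the traces on the [us i], and axiom (d) leaves countably
    many choices for each of these. *)
Lemma countable_traces {S : set (set G)} {k} {us : nat -> set G} :
  (forall s, S s -> countable [set s `&` t | t in S]) ->
  (forall i, (i < k)%N -> S (us i)) ->
  countable [set s `&` union_fam k us | s in S].
Proof.
move=> Sd; elim: k => [|k IH] Sus.
  apply: (@sub_countable _ _ _ [set set0]) => //; apply: subset_card_le.
  by move=> _ [s _ <-] /=; rewrite /union_fam II0 bigcup_set0 setI0.
have cnt := countableX (IH (fun i ik => Sus i (ltnW ik))) (Sd _ (Sus k (ltnSn k))).
apply: (@sub_countable _ _ _ [set p.1 `|` p.2 | p in
  [set s `&` union_fam k us | s in S] `*` [set us k `&` t | t in S]]).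
  apply: subset_card_le => _ [s Ss <-].
  exists (s `&` union_fam k us, us k `&` s).
    by split; exists s.
  rewrite /= [us k `&` s]setIC -setIUr; congr (_ `&` _).
  apply/seteqP; split=> a.
    move=> [[i /= ik ia]|ka]; first by exists i => //=; rewrite ltnS ltnW.
    by exists k => /=.
  move=> [i /=]; rewrite ltnS leq_eqVlt => /orP[/eqP->|ik] ia; [by right|].
  by left; exists i.
exact: (sub_countable (card_image_le _ _)).
Qed.

Context {S : set (set G)}.
Hypothesis SCI : countably_intersected S.
Context {phi : nat -> G -> R} {M : R}.
Hypotheses (fphi : forall n, fin_supp (phi n)) (phiM : forall n, jnorm S (phi n) <= M).

Let oscillating_family (e : R) (L : set nat) k :=
  exists (ts : nat -> set G) (L' : set nat),
  [/\ L' `<=` L, unbounded_set L', family_in S k ts, pw_disjoint k ts &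
      forall i n, (i < k)%N -> L' n -> e / 4 < `|ssum (phi n) (ts i)|].

Lemma oscillating_familyS (e : R) (L : set nat) k : 0 < e ->
  (forall L', L' `<=` L -> unbounded_set L' ->
     exists2 s, S s & ~ osc_le L' (fun n => ssum (phi n) s) e) ->
  oscillating_family e L k -> oscillating_family e L k.+1.
Proof.
move=> e0 H [ts [L1 [L1L uL1 tsS tsd tsbig]]].
have [[_ Ssing _] _ [sig [sigS Sc]] Sd] := SCI.
pose U := union_fam k (sig \o ts).
(* Axiom (c) is stated for at least one removed set, so [k = 0] is treated apart, with [t = s]. *)
have Sdecomp s : S s ->
    exists t, [/\ S t, t `<=` s `\` U & finite_set (s `\` (U `|` t))].
  move=> Ss; have [k0|k0] := posnP k; last exact: Sc.
  have U0 : U = set0 by rewrite /U /union_fam k0 II0 bigcup_set0.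
  by exists s; split=> //; rewrite U0 ?setD0// set0U setDv.
pose D := \bigcup_n [set a | phi n a != 0].
(* These are the sets whose sums are made to converge first: the traces on [U], and the points of
   the supports, a countable union of finite sets. *)
pose A := [set s `&` U | s in S] `|` [set [set a] | a in D].
have cA : countable A.
  rewrite /A -bigcup2E; apply: bigcup_countable => // -[|[|i]] _ //=.
    by apply: countable_traces => // i ik; have [] := sigS _ (tsS i ik).
  apply: (sub_countable (card_image_le _ _)).
  apply: bigcup_countable => // n _.
  exact/finite_set_countable/fphi.
have bS s n : S s -> `|ssum (phi n) s| <= M.
  by move=> Ss; exact: le_trans (ssum_le_jnorm S s (fphi n) Ss) (phiM n).
have split_sum s t n : t `<=` s `\` U ->
    ssum (phi n) s = ssum (phi n) (s `&` U) +
      (ssum (phi n) t + ssum (phi n) (s `\` (U `|` t))).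
  move=> tsU; rewrite -!ssumU//.
  - congr ssum; apply/seteqP; split=> a.
      move=> sa; have [Ua|nUa] := pselect (U a); first by left.
      have [ta|nta] := pselect (t a); first by right; left.
      by right; right; split=> // -[].
    by move=> [[]//|[/tsU[]//|[]//]].
  - by apply/seteqP; split=> a // [[sa Ua] [/tsU[]//|[_ nUt]]]; apply: nUt; left.
  - by apply/seteqP; split=> a // [ta [_ nUt]]; apply: nUt; right.
(* A trace [s] on [U] need not belong to [S]. Its sum is that of [s] minus those of [t] and of a
   finite remainder, each bounded uniformly in [n]. *)
have bA w : A w -> exists b : R, forall n, `|ssum (phi n) w| <= b.
  move=> [[s Ss <-]|[a _ <-]]; last first.
    by exists M => n; apply: bS; exact: Ssing.
  have [t [St tsU fF]] := Sdecomp s Ss.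
  set F := s `\` (U `|` t) in fF *.
  exists (M + (M + \sum_(a <- fset_set F) M)) => n.
  have := split_sum s t n tsU; rewrite -/F => /eqP.
  rewrite -subr_eq => /eqP <-.
  apply: (le_trans (ler_normB _ _)); apply: lerD; first exact: bS.
  apply: (le_trans (ler_normD _ _)); apply: lerD; first exact: bS.
  rewrite /ssum fsbig_finite//; apply: (le_trans (ler_norm_sum _ _ _)).
  apply: ler_sum => a _; rewrite -[phi n a](@ssum1 _ _ (phi n)).
  by apply: bS; exact: Ssing.
have [L2 [L21 uL2 oscA]] := diagonal_subsequence A (fun w n => ssum (phi n) w) cA bA uL1.
have L2L : L2 `<=` L by apply: subset_trans L1L.
have [s Ss nosc] := H L2 L2L uL2.
have [t [St tsU fF]] := Sdecomp s Ss.
(* The trace on [U] and the finite remainder eventually oscillate by at most [e / 4] each, so the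
   rest of the oscillation of [s] comes from [t]. *)
have nosct : ~ osc_le L2 (fun n => ssum (phi n) t) (e / 2).
  move=> osct; apply: nosc.
  have e40 : 0 < e / 4 by rewrite divr_gt0.
  have oscF : osc_le L2 (fun n => ssum (phi n) (s `\` (U `|` t))) (e / 4).
    apply: osc_le_finite => // a d d0.
    have [Da|nDa] := pselect (D a).
      have [|N hN] := oscA [set a] d _ d0; first by right; exists a.
      by exists N => m n; have := hN m n; rewrite !ssum1.
    have z n : phi n a = 0.
      by apply/eqP; apply: contrapT => /negP h; apply: nDa; exists n.
    by exists 0%N => m n _ _ _ _; rewrite !z subrr normr0 ltW.
  have oscU : osc_le L2 (fun n => ssum (phi n) (s `&` U)) (e / 4).
    by apply: oscA => //; left; exists s.
  have := osc_leD oscU (osc_leD osct oscF).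
  have -> : e / 4 + (e / 2 + e / 4) = e by field.
  move=> [N hN]; exists N => m n Nm Nn Lm Ln.
  by rewrite !(split_sum s t)//; exact: hN.
exists (fun i => if (i < k)%N then ts i else t).
exists [set n | L2 n /\ e / 4 < `|ssum (phi n) t|]; split.
- by move=> n [/L2L].
(* If the sums over [t] stayed within [e / 4] of zero from [m] on, they would oscillate by at most
   [e / 2]. *)
- move=> m; apply: contrapT => h; apply: nosct; exists m => p q mp mq L2p L2q.
  have aux r : (m <= r)%N -> L2 r -> `|ssum (phi r) t| <= e / 4.
    by move=> mr L2r; rewrite leNgt; apply/negP => er; apply: h; exists r.
  by have := aux p mp L2p; have := aux q mq L2q; rewrite !ler_norml; lra.
- by move=> i _ /=; case: ifP => // ik; exact: tsS.
- have tst i : (i < k)%N -> ts i `&` t = set0.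
    move=> ik; apply/seteqP; split=> // a [ia /tsU[_]]; apply; exists i => //=.
    by have [_] := sigS _ (tsS i ik); apply.
  move=> i j; rewrite !ltnS => ik jk ij.
  case: ifP => ik'; case: ifP => jk'; [exact: tsd|exact: tst|rewrite setIC; exact: tst|].
  by case: ij; lia.
- move=> i n _ [L2n tn] /=; case: ifP => // ik; apply: tsbig => //.
  exact: L21.
Qed.

Lemma exists_small_oscillation (e : R) (L : set nat) : 0 < e -> unbounded_set L ->
  exists L', [/\ L' `<=` L, unbounded_set L' &
    forall s, S s -> osc_le L' (fun n => ssum (phi n) s) e].
Proof.
move=> e0 uL; apply: contrapT => nex.
have H L' : L' `<=` L -> unbounded_set L' ->
     exists2 s, S s & ~ osc_le L' (fun n => ssum (phi n) s) e.
  move=> sL uL'; apply: contrapT => h; apply: nex; exists L'; split=> // s Ss.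
  by apply: contrapT => ho; apply: h; exists s.
have fam k : oscillating_family e L k.
  elim: k => [|k IH]; last exact: oscillating_familyS.
  by exists (fun=> set0), L; split=> //; move=> i; rewrite ltn0.
(* Chosen so that [k] disjoint sets with sums above [e / 4] force a squared norm above [M ^+ 2]. *)
pose k := (Num.truncn (M ^+ 2 / (e / 4) ^+ 2)).+1.
have [ts [L' [_ uL' tsS tsd big]]] := fam k.
have [n _ L'n] := uL' 0%N.
have e40 : 0 < e / 4 by rewrite divr_gt0.
have : k%:R * (e / 4) ^+ 2 <= M ^+ 2.
  apply: (@le_trans _ _ (jnorm S (phi n) ^+ 2)); last first.
    by rewrite lerXn2r ?nnegrE ?jnorm_ge0// (le_trans (jnorm_ge0 S (phi n))).
  apply: le_trans (sum_ssum_le S (fphi n) tsS tsd).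
  have -> : k%:R * (e / 4) ^+ 2 = \sum_(i < k) (e / 4) ^+ 2.
    by rewrite sumr_const card_ord mulr_natl.
  apply: ler_sum => i _; rewrite -[leRHS]real_normK ?num_real//.
  by rewrite lerXn2r ?nnegrE// ltW// big.
rewrite -ler_pdivlMr ?exprn_gt0//; apply/negP; rewrite -ltNge.
exact: truncnS_gt.
Qed.

End Oscillation.

(** * Convex blocks and the Mazur type argument *)

Section ConvexBlocks.
Context {G : choiceType} {R : realType} (y : nat -> G -> R).

Inductive conv_block (m n : nat) : (G -> R) -> Prop :=
| ConvPoint i : (m <= i < n)%N -> conv_block m n (y i)
| ConvComb u v (x : R) : conv_block m n u -> conv_block m n v -> 0 <= x <= 1 ->
    conv_block m n (x *: u + (1 - x) *: v).

Lemma conv_block_sub {m n m' n' u} : (m' <= m)%N -> (n <= n')%N ->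
  conv_block m n u -> conv_block m' n' u.
Proof.
move=> mm nn; elim=> [i /andP[mi ni]|v w x _ IHv _ IHw x01].
  by apply: ConvPoint; rewrite (leq_trans mm)// (leq_trans ni).
exact: ConvComb.
Qed.

Lemma conv_block_weights {m n u} : conv_block m n u ->
  exists p : nat -> R, [/\ forall i, 0 <= p i, \sum_(m <= i < n) p i = 1 &
    u = \sum_(m <= i < n) p i *: y i].
Proof.
elim=> [i mn|v w x _ [p [p0 p1 ->]] _ [q [q0 q1 ->]] /andP[x0 x1]].
  exists (fun j => (j == i)%:R); split=> //.
    rewrite (bigD1_seq i) ?mem_index_iota ?iota_uniq//= eqxx big1 ?addr0//.
    by move=> j /negbTE ->.
  rewrite (bigD1_seq i) ?mem_index_iota ?iota_uniq//= eqxx scale1r big1 ?addr0//.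
  by move=> j /negbTE ->; rewrite scale0r.
exists (fun i => x * p i + (1 - x) * q i); split=> [i||].
- by rewrite addr_ge0// mulr_ge0// subr_ge0.
- by rewrite big_split /= -!mulr_sumr p1 q1; ring.
- rewrite !scaler_sumr -big_split /=; apply: eq_bigr => i _.
  by rewrite [RHS]scalerDl !scalerA.
Qed.

Hypothesis fy : forall i, fin_supp (y i).

Lemma fin_supp_conv_block {m n u} : conv_block m n u -> fin_supp u.
Proof. by elim=> // v w x _ fv _ fw _; exact: fin_supp_comb. Qed.

Lemma ssum_convex_le {u v} {x c : R} {s : set G} : fin_supp u -> fin_supp v -> 0 <= x <= 1 ->
  `|ssum u s| <= c -> `|ssum v s| <= c -> `|ssum (x *: u + (1 - x) *: v) s| <= c.
Proof.
move=> fu fv /andP[x0 x1] uc vc; rewrite ssum_comb// (le_trans (ler_normD _ _))//.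
rewrite !normrM (ger0_norm x0) (ger0_norm (_ : 0 <= 1 - x)) ?subr_ge0//.
by nra.
Qed.

Lemma ssum_conv_block_le {m n u} {c : R} {s : set G} : conv_block m n u ->
  (forall i, (m <= i < n)%N -> `|ssum (y i) s| <= c) -> `|ssum u s| <= c.
Proof.
move=> + h; elim=> [i /h//|v w x cv IHv cw IHw x01].
by apply: ssum_convex_le => //; [exact: fin_supp_conv_block cv|exact: fin_supp_conv_block cw].
Qed.

(** Quantifying [small_blocks] over all such [C] allows smallness on several families to be imposed
    in turn: the elements of [C] that are small on one family form a set of the same kind. *)
Record cofinal_convex (C : set (G -> R)) := CofinalConvex {
  cofinal_fin_supp : forall u, C u -> fin_supp u ;
  cofinal_closed : forall u v (x : R), C u -> C v -> 0 <= x <= 1 ->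
    C (x *: u + (1 - x) *: v) ;
  cofinal_exists : forall m, exists n u, conv_block m n u /\ C u }.

Definition small_blocks (e : R) (K : set (set G)) := forall C (d : R) m,
  cofinal_convex C -> 0 < d ->
  exists n u, [/\ conv_block m n u, C u & forall s, K s -> `|ssum u s| <= e + d].

Lemma small_blocks_finite_union {e : R} {K : nat -> set (set G)} {m n : nat} :
  (forall i, (m <= i < n)%N -> small_blocks e (K i)) ->
  small_blocks e (\bigcup_(i in [set i | (m <= i < n)%N]) K i).
Proof.
move=> hK C d p cC d0.
suff [C' [C'C cC' C's]] : exists C', [/\ C' `<=` C, cofinal_convex C' &
    forall u i s, (m <= i < n)%N -> C' u -> K i s -> `|ssum u s| <= e + d].
  have [q [u [cu C'u]]] := cofinal_exists _ cC' p.
  exists q, u; split=> //; first exact: C'C.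
  by move=> s [i /= mn Ks]; exact: (C's u i).
elim: n hK => [_|n IH hK]; first by exists C; split=> // u i s; rewrite ltn0 andbF.
have [|C' [C'C cC' C's]] := IH.
  by move=> i /andP[mi ni]; apply: hK; rewrite mi ltnW.
have [nm|mn] := ltnP n m.
  by exists C'; split=> // u i s /andP[mi ni]; lia.
exists [set u | C' u /\ forall s, K n s -> `|ssum u s| <= e + d]; split.
- by move=> u [/C'C].
- split=> [u [C'u _]|u v x [C'u hu] [C'v hv] x01|q].
  + exact: cofinal_fin_supp C'u.
  + split; first exact: cofinal_closed.
    move=> s Ks; apply: ssum_convex_le => //; [|
      |exact: hu|exact: hv]; by apply: (cofinal_fin_supp _ cC').
  + have [|r [u [cu C'u hu]]] := hK n _ C' d q cC' d0; first by rewrite mn /=.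
    by exists r, u.
- move=> u i s /andP[mi]; rewrite ltnS leq_eqVlt => /orP[/eqP->|ni] [C'u hu] Ks.
    exact: hu.
  by apply: (C's u i) => //; rewrite mi.
Qed.

Context {e M : R}.
Hypotheses (e0 : 0 <= e).

Definition hit (i : nat) : set (set G) := [set s | e <= `|ssum (y i) s|].

(* Averaging: if blocks [u_1, ..., u_k] are such that [u_j] is small on the
   sets hit before the start of [u_j], then on each [s] all but the first
   [u_j] meeting [s] contribute at most [e + d] to the average. *)
Lemma small_blocks_of_hit (K : set (set G)) m0 :
  (forall i s, K s -> `|ssum (y i) s| <= M) ->
  (forall i, (m0 <= i)%N -> small_blocks e (K `&` hit i)) -> small_blocks e K.
Proof.
move=> KM hK C d m' cC d0.
pose m := maxn m0 m'.
(* [u] is an average of [k] blocks. The error [M] does not grow with [k], so dividing by a large [k]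
   brings it below [d / 2]. *)
suff avg k : exists n u, [/\ conv_block m n u, C u &
    forall s, K s -> k%:R * `|ssum u s| <= k%:R * (e + d / 2) + M].
  pose k := (Num.truncn (M / (d / 2))).+1.
  have [n [u [cu Cu hu]]] := avg k.
  exists n, u; split=> //.
    by apply: (conv_block_sub _ _ cu) => //; rewrite leq_maxr.
  move=> s Ks; have k0 : 0 < k%:R :> R by rewrite ltr0n.
  rewrite -(ler_pM2l k0); apply: (le_trans (hu s Ks)).
  have : M <= k%:R * (d / 2).
    by rewrite -ler_pdivrMr ?divr_gt0// ltW// truncnS_gt.
  by lra.
elim: k => [|k [n [u [cu Cu hu]]]].
  have [n [u [cu Cu]]] := cofinal_exists _ cC m.
  exists n, u; split=> // s Ks; rewrite !mul0r add0r.
  exact: (le_trans (normr_ge0 (ssum (y 0%N) s)) (KM _ _ Ks)).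
have hKi i : (m <= i < n)%N -> small_blocks e (K `&` hit i).
  by move=> /andP[mi _]; apply: hK; apply: leq_trans mi; rewrite leq_maxl.
have d20 : 0 < d / 2 by rewrite divr_gt0.
(* The next block starts after [u] ends and is small on every set hit by some [y i] with
   [m <= i < n]; the weight [x] then updates the running average. *)
have [n' [v [cv Cv hv]]] := small_blocks_finite_union hKi C (d / 2) (maxn m n) cC d20.
pose x : R := k%:R / k.+1%:R.
have k1 : 0 < k.+1%:R :> R by rewrite ltr0n.
have x01 : 0 <= x <= 1.
  by rewrite /x divr_ge0//= ler_pdivrMr// mul1r ler_nat leqnSn.
have fu := cofinal_fin_supp _ cC _ Cu; have fv := cofinal_fin_supp _ cC _ Cv.
exists (maxn n n'), (x *: u + (1 - x) *: v); split.
- apply: ConvComb => //.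
    by apply: (conv_block_sub _ _ cu) => //; rewrite leq_maxl.
  by apply: (conv_block_sub _ _ cv); rewrite ?leq_maxl ?leq_maxr.
- exact: cofinal_closed.
move=> s Ks; rewrite ssum_comb//.
have -> : x * ssum u s + (1 - x) * ssum v s = (k%:R * ssum u s + ssum v s) / k.+1%:R.
  by rewrite /x -natr1; field; rewrite natr1 gt_eqF.
rewrite normrM (@gtr0_norm _ k.+1%:R^-1) ?invr_gt0// mulrCA divff ?gt_eqF// mulr1.
apply: (le_trans (ler_normD _ _)); rewrite normrM ger0_norm//.
(* If [s] is hit in the range of [u], then [v] is small on [s] and the bound for [u] carries over.
   Otherwise [u] is at most [e] on [s], and the error [M] is spent on [v] alone. *)
have [[i /andP[mi ni] hi]|nhit] := pselect (exists2 i, (m <= i < n)%N & e <= `|ssum (y i) s|).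
  have := hv s; have : K s by []; have := hu s Ks.
  move=> hus _ /(_ _)hvs; have : `|ssum v s| <= e + d / 2.
    by apply: hvs; exists i => //=; rewrite mi.
  by move: hus; rewrite -natr1; lra.
have us : `|ssum u s| <= e.
  apply: (ssum_conv_block_le cu) => i mn; rewrite leNgt; apply/negP => ei.
  by apply: nhit; exists i => //; exact: ltW.
have vs : `|ssum v s| <= M.
  by apply: (ssum_conv_block_le cv) => i _; exact: KM.
have kus : k%:R * `|ssum u s| <= k%:R * e by rewrite ler_wpM2l.
have kd : 0 <= k%:R * (d / 2) by rewrite mulr_ge0// ltW.
by rewrite -natr1 mulrDl mul1r mulrDr; have := e0; lra.
Qed.

(** If the conclusion failed, [small_blocks_of_hit] would yield indices tending to infinity and
    decreasing nonempty families of sets hit at all indices chosen so far. A cluster point of such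
    sets would be hit infinitely often. *)
Lemma mazur_pointwise (S : set (set G)) : pointwise_closed S ->
  (forall i s, S s -> `|ssum (y i) s| <= M) ->
  (forall s, S s -> exists N, forall i, (N <= i)%N -> `|ssum (y i) s| < e) ->
  small_blocks e S.
Proof.
move=> Scl SM Sev; apply: contrapT => nS.
have next (p : set (set G) * nat) : exists i, p.1 `<=` S -> ~ small_blocks e p.1 ->
    (p.2 <= i)%N /\ ~ small_blocks e (p.1 `&` hit i).
  have [[KS nK]|h] := pselect (p.1 `<=` S /\ ~ small_blocks e p.1); last first.
    by exists 0%N => KS nK; case: h.
  apply: contrapT => h; apply: nK; apply: (@small_blocks_of_hit _ p.2).
    by move=> i s /KS; exact: SM.
  by move=> i pi; apply: contrapT => ni; apply: h; exists i.
have [f hf] := choice next.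
pose step p := (p.1 `&` hit (f p), (f p).+1).
pose K k := iter k step (S, 0%N).
have KP k : (K k).1 `<=` S /\ ~ small_blocks e (K k).1.
  elim: k => [|k [KS nK]]; first by split.
  have [_ nK'] := hf _ KS nK; split=> //.
  by move=> s [/KS].
have Kle k : (k <= (K k).2)%N.
  elim: k => // k IH; have [KS nK] := KP k; have [le _] := hf _ KS nK.
  by rewrite /= ltnS (leq_trans IH).
have Kdec j k : (j <= k)%N -> (K k).1 `<=` (K j).1.
  move=> /subnK <-; elim: (k - j)%N => // i IH.
  by rewrite addSn => s [/IH].
(* On an empty family smallness holds vacuously, so each [(K k).1] is nonempty. *)
have /choice[s hs] : forall k, exists s, (K k).1 s.
  move=> k; apply: contrapT => h; have [KS nK] := KP k; apply: nK.
  move=> C d m cC d0; have [n [u [cu Cu]]] := cofinal_exists _ cC m.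
  by exists n, u; split=> // s Ks; case: h; exists s.
have [t St ht] := @pointwise_closed_cluster G R S s Scl (fun k => (KP k).1 _ (hs k)).
have [N hN] := Sev t St.
have [KS nK] := KP N; have [le _] := hf _ KS nK.
have := hN (f (K N)) (leq_trans (Kle N) le).
have [k Nk <-] := ht _ (fy (f (K N))) N.+1.
have [_] : (K N.+1).1 (s k) by exact: Kdec (hs k).
by rewrite /hit /= leNgt => /negP.
Qed.

End ConvexBlocks.

(** * James norms of sums *)

Section JamesSums.
Context {G : choiceType} {R : realType} (S : set (set G)).
Implicit Types phi psi : G -> R.

Lemma jnorm_sum {I : Type} (r : seq I) (a : I -> R) (u : I -> G -> R) :
  (forall i, fin_supp (u i)) ->
  fin_supp (\sum_(i <- r) a i *: u i) /\
  jnorm S (\sum_(i <- r) a i *: u i) <= \sum_(i <- r) `|a i| * jnorm S (u i).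
Proof.
move=> fu; elim: r => [|i r [IHf IH]].
  rewrite !big_nil; split; first by apply/fin_suppP; exists fset0.
  apply: jnorm_le => // n f _ _; rewrite big1 ?sqr_ge0// => k _.
  by rewrite (@ssumE _ _ _ fset0)// big_seq_fset0 expr0n.
rewrite !big_cons -[X in _ + X]scale1r; split; first exact: fin_supp_comb.
apply: (le_trans (jnorm_comb S (a i) 1 (fu i) IHf)).
by rewrite normr1 mul1r lerD2l.
Qed.

(* A set missing the support of [phi] contributes only through [psi], and at
   most [size A] of the disjoint sets meet the support [A] of [phi]. *)
Lemma jnormD_sqr {phi psi} {A : {fset G}} {d : R} :
  (forall a, a \notin A -> phi a = 0) -> fin_supp psi -> 0 <= d ->
  (forall s, S s -> `|ssum psi s| <= d) ->
  jnorm S (phi + psi) ^+ 2 <= jnorm S phi ^+ 2 + jnorm S psi ^+ 2 +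
    (size A)%:R * (2 * jnorm S phi * d).
Proof.
move=> A0 fpsi d0 psid; set X := (X in _ <= X).
have fphi : fin_supp phi by apply/fin_suppP; exists A.
have X0 : 0 <= X by rewrite /X !addr_ge0 ?sqr_ge0 ?mulr_ge0 ?jnorm_ge0.
have c0 : 0 <= 2 * jnorm S phi * d by rewrite !mulr_ge0 ?jnorm_ge0.
rewrite -(sqr_sqrtr X0) lerXn2r ?nnegrE ?jnorm_ge0 ?sqrtr_ge0//.
apply: jnorm_le; rewrite ?sqrtr_ge0// sqr_sqrtr// => n f fS fd.
apply: (@le_trans _ _ (\sum_(k < n) ssum phi (f k) ^+ 2 + \sum_(k < n) ssum psi (f k) ^+ 2
    + (\sum_(k < n) \sum_(a <- A) (a \in f k)%:R) * (2 * jnorm S phi * d))); last first.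
  by rewrite !lerD ?sum_ssum_le// ler_wpM2r// hits_le_card.
rewrite mulr_suml -!big_split /=; apply: ler_sum => k _.
rewrite -[phi]scale1r -[psi]scale1r ssum_comb// !scale1r !mul1r.
have [->|nz] := eqVneq (ssum phi (f k)) 0.
  by rewrite add0r expr0n add0r lerDl mulr_ge0// sumr_ge0.
have hit1 := ssum_hit (f k) A0 nz.
suff : ssum phi (f k) * ssum psi (f k) *+ 2 <=
    (\sum_(a <- A) (a \in f k)%:R) * (2 * jnorm S phi * d) by rewrite sqrrD; lra.
apply: (@le_trans _ _ (2 * jnorm S phi * d)); last by rewrite ler_peMl.
have : `|ssum phi (f k)| * `|ssum psi (f k)| <= jnorm S phi * d.
  by rewrite ler_pM// ?psid ?ssum_le_jnorm//; exact: fS.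
have := ler_norm (ssum phi (f k) * ssum psi (f k)); rewrite normrM; lra.
Qed.

End JamesSums.

(** * Blocks of prescribed l^1 weight and the growth of their norms *)

Section Blocks.
Context {G : choiceType} {R : realType} (phi : nat -> G -> R).

Definition l1_block (m n : nat) (r : R) (u : G -> R) := exists a : nat -> R,
  u = \sum_(m <= i < n) a i *: phi i /\ r = \sum_(m <= i < n) `|a i|.

Lemma l1_block_zero m n : l1_block m n 0 0.
Proof.
exists (fun=> 0); split; first by rewrite big1// => i _; rewrite scale0r.
by rewrite big1// => i _; rewrite normr0.
Qed.

Lemma l1_block_single i x : l1_block i i.+1 `|x| (x *: phi i).
Proof. by exists (fun=> x); rewrite !big_nat1. Qed.

Lemma l1_blockZ {m n r u} x : l1_block m n r u -> l1_block m n (`|x| * r) (x *: u).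
Proof.
move=> [a [-> ->]]; exists (fun i => x * a i); split.
  by rewrite scaler_sumr; apply: eq_bigr => i _; rewrite scalerA.
by rewrite mulr_sumr; apply: eq_bigr => i _; rewrite normrM.
Qed.

(** The index intervals are disjoint, so the coefficients are glued without cancellation and the
    weights add exactly. *)
Lemma l1_blockD {m n p r r' u v} : (m <= n)%N -> (n <= p)%N ->
  l1_block m n r u -> l1_block n p r' v -> l1_block m p (r + r') (u + v).
Proof.
move=> mn np [a [-> ->]] [b [-> ->]].
exists (fun i => if (i < n)%N then a i else b i).
rewrite !(big_cat_nat mn np) /=.
split; congr (_ + _); apply: eq_big_nat => i /andP[].
- by move=> _ ->.
- by rewrite leqNgt => /negbTE ->.
- by move=> _ ->.
- by rewrite leqNgt => /negbTE ->.
Qed.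

Lemma l1_block_sub {m n m' n' r u} : (m' <= m)%N -> (m <= n)%N -> (n <= n')%N ->
  l1_block m n r u -> l1_block m' n' r u.
Proof.
move=> mm mn nn hu; rewrite -[r]addr0 -[u]addr0.
apply: (l1_blockD _ nn _ (l1_block_zero n n')); first exact: leq_trans mn.
rewrite -[r]add0r -[u]add0r.
exact: (l1_blockD mm mn (l1_block_zero m' m)).
Qed.

Context {S : set (set G)}.
Hypothesis SCI : countably_intersected S.
Context {M : R}.
Hypotheses (fphi : forall n, fin_supp (phi n)) (phiM : forall n, jnorm S (phi n) <= M).

Lemma l1_block_jnorm {m n r u} : l1_block m n r u ->
  fin_supp u /\ jnorm S u <= r * M.
Proof.
move=> [a [-> ->]].
have [fu hu] := jnorm_sum S (index_iota m n) a phi fphi.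
split=> //; apply: (le_trans hu); rewrite mulr_suml; apply: ler_sum => i _.
by rewrite ler_wpM2l.
Qed.

Lemma exists_small_block (d : R) m : 0 < d ->
  exists n u, [/\ (m <= n)%N, l1_block m n 1 u & forall s, S s -> `|ssum u s| <= d].
Proof.
move=> d0; pose e := d / 2; have e0 : 0 < e by rewrite divr_gt0.
have uL : unbounded_set [set n | (m <= n)%N].
  by move=> k; exists (maxn m k); rewrite /= ?leq_maxl ?leq_maxr.
have [L [Lm uL' osc]] := exists_small_oscillation SCI fphi phiM e _ e0 uL.
have /choice[g hg] : forall k, exists n, (k <= n)%N /\ L n.
  by move=> k; have [n kn Ln] := uL' k; exists n.
pose l k := iter k (fun n => g n.+1) (g m).
have Ll k : L (l k) by case: k => [|k]; exact: (hg _).2.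
have lS k : (l k < l k.+1)%N by exact: (hg _).1.
have lk k : (k <= l k)%N by elim: k => // k IH; exact: leq_ltn_trans (lS k).
(* Half differences over disjoint pairs of indices: each has weight 1, hence so has every convex
   combination. The factor 1/2 also turns oscillation at most [e] into sums strictly below [e]. *)
pose y j := 2^-1 *: phi (l j.*2) + (- 2^-1) *: phi (l j.*2.+1).
have fy j : fin_supp (y j) by exact: fin_supp_comb.
have yM j s : S s -> `|ssum (y j) s| <= M.
  move=> Ss; apply: (le_trans (ssum_le_jnorm S s (fy j) Ss)).
  apply: (le_trans (jnorm_comb S _ _ (fphi _) (fphi _))).
  have := phiM (l j.*2); have := phiM (l j.*2.+1).
  by rewrite normrN gtr0_norm ?invr_gt0//; lra.
have ysmall s : S s -> exists N, forall j, (N <= j)%N -> `|ssum (y j) s| < e.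
  move=> /osc[N hN]; exists N => j Nj.
  rewrite ssum_comb// mulNr -mulrBr normrM gtr0_norm ?invr_gt0//.
  have := hN (l j.*2) (l j.*2.+1) _ _ (Ll _) (Ll _).
  have Nl : (N <= l j.*2)%N by apply: leq_trans (lk _); lia.
  by move=> /(_ Nl (leq_trans Nl (ltnW (lS _)))) /=; lra.
have [[_ _ Scl] _ _ _] := SCI.
have := mazur_pointwise y fy (ltW e0) S Scl yM ysmall.
(* [C] imposes no restriction beyond being a convex block, and the error [e + e] is [d]. *)
move=> /(_ [set u | exists p q, conv_block y p q u] e 0%N) [|//|n [u [cu _ hu]]].
  split=> [u [p [q cu]]|u v x [p [q cu]] [p' [q' cv]] x01|p].
  - exact: fin_supp_conv_block cu.
  - exists (minn p p'), (maxn q q'); apply: ConvComb => //.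
      by apply: (conv_block_sub _ _ _ cu); rewrite ?geq_minl ?leq_maxl.
    by apply: (conv_block_sub _ _ _ cv); rewrite ?geq_minr ?leq_maxr.
  - exists p.+1, (y p); have c : conv_block y p p.+1 (y p) by apply: ConvPoint; rewrite leqnn /=.
    by split=> //; exists p, p.+1.
have [p [p0 p1 uE]] := conv_block_weights _ cu.
have lmono a b : (a <= b)%N -> (l a <= l b)%N.
  move=> /subnK <-; elim: (b - a)%N => // i IH; rewrite addSn.
  exact: leq_trans IH (ltnW (lS _)).
have yblock j : l1_block (l j.*2) (l j.*2.+2) 1 (y j).
  have -> : 1 = `|2^-1| + `|- 2^-1| :> R by rewrite normrN gtr0_norm ?invr_gt0//; field.
  apply: (@l1_blockD _ (l j.*2).+1); [by []
    |by apply: leq_trans (lS _); rewrite ltnS ltnW// lS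
    |exact: l1_block_single|].
  by apply: (@l1_block_sub (l j.*2.+1) (l j.*2.+1).+1); rewrite ?lS//; exact: l1_block_single.
have block b : l1_block (l 0%N) (l b.*2) (\sum_(0 <= j < b) p j) (\sum_(0 <= j < b) p j *: y j).
  elim: b => [|b IH]; first by rewrite !big_geq//; exact: l1_block_zero.
  rewrite !big_nat_recr//=; apply: (l1_blockD _ _ IH).
  - exact: (lmono 0%N b.*2 (leq0n _)).
  - by apply: (lmono b.*2 b.+1.*2); rewrite doubleS; lia.
  - have := l1_blockZ (p b) (yblock b); rewrite ger0_norm// mulr1 ?doubleS; apply.
have ml0 : (m <= l 0%N)%N by exact: (hg _).1.
exists (l n.*2), u; split.
- exact: leq_trans ml0 (lmono 0%N n.*2 (leq0n _)).
- rewrite -p1 uE; apply: l1_block_sub (block n) => //; exact: (lmono 0%N n.*2 (leq0n _)).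
- by move=> s Ss; rewrite (le_trans (hu s Ss))// /e; lra.
Qed.

Lemma block_growth k : exists n u,
  l1_block 0 n k%:R u /\ jnorm S u ^+ 2 <= k%:R * (M ^+ 2 + 1).
Proof.
elim: k => [|k [n [w [bw hw]]]].
  exists 0%N, 0; split; first exact: l1_block_zero.
  have [_ h] := l1_block_jnorm (l1_block_zero 0 0).
  rewrite mul0r in h; rewrite mul0r; have := jnorm_ge0 S (0 : G -> R).
  by move=> h'; rewrite (_ : jnorm S 0 = 0) ?expr0n//; apply/eqP; rewrite eq_le h.
have [fw _] := l1_block_jnorm bw.
have [A A0] := (fin_suppP w).1 fw.
pose c := (size A)%:R * (2 * jnorm S w) : R.
have c0 : 0 <= c by rewrite !mulr_ge0 ?jnorm_ge0.
(* With this [d] the cross term of [jnormD_sqr] is [c / (c + 1)], so each new block adds at most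
   [M ^+ 2 + 1]. *)
pose d := (c + 1)^-1; have d0 : 0 < d by rewrite invr_gt0 ltr_wpDl.
have [n' [z [nn' bz zd]]] := exists_small_block d n d0.
have [fz hz] := l1_block_jnorm bz.
exists n', (w + z); split; first by rewrite -natr1; exact: l1_blockD bz.
apply: (le_trans (jnormD_sqr S A0 fz (ltW d0) zd)).
have zM : jnorm S z ^+ 2 <= M ^+ 2.
  rewrite mul1r in hz; rewrite lerXn2r ?nnegrE ?jnorm_ge0//.
  exact: le_trans (jnorm_ge0 S z) hz.
have : (size A)%:R * (2 * jnorm S w * d) <= 1.
  by rewrite mulrA -/c /d ler_pdivrMr ?mul1r ?lerDl// ltr_wpDl.
by rewrite -natr1; lra.
Qed.

Lemma no_lower_l1_estimate (c : R) : 0 < c ->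
  ~ (forall n (a : nat -> R),
       c * (\sum_(0 <= i < n) `|a i|) <= jnorm S (\sum_(0 <= i < n) a i *: phi i)).
Proof.
(* The lower estimate gives [(c * k) ^+ 2 <= k * (M ^+ 2 + 1)], which fails for this [k]. *)
move=> c0 low; pose k := (Num.truncn ((M ^+ 2 + 1) / c ^+ 2)).+1.
have [n [u [[a [uE rE]] hu]]] := block_growth k.
have k0 : 0 < k%:R :> R by rewrite ltr0n.
have ck : c * k%:R <= jnorm S u by rewrite uE rE; exact: low.
have : (c * k%:R) ^+ 2 <= k%:R * (M ^+ 2 + 1).
  by apply: le_trans hu; rewrite lerXn2r ?nnegrE ?jnorm_ge0// mulr_ge0// ltW.
rewrite exprMn mulrC -mulrA ler_pM2l// -ler_pdivlMr ?exprn_gt0//.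
by apply/negP; rewrite -ltNge truncnS_gt.
Qed.

End Blocks.

(** * Finitely supported sequences in l^1 *)

Section FinitelySupportedSequences.
Context {R : realType}.

Lemma l1_finite {n} {a : nat -> R} : (forall i, (n <= i)%N -> a i = 0) ->
  l1 a /\ l1norm a = \sum_(0 <= i < n) `|a i|.
Proof.
move=> a0.
have h : series (fun k => `|a k|) @ \oo --> \sum_(0 <= i < n) `|a i|.
  apply: cvg_near_cst; exists n => // m /= nm.
  rewrite /series /= (big_cat_nat (leq0n n) nm) /= [X in _ + X]big_nat_cond.
  rewrite [X in _ + X]big1 ?addr0// => i /andP[/andP[ni _] _].
  by rewrite a0// normr0.
by split; [apply: cvgP h|exact: cvg_lim h].
Qed.

Definition truncate (a : nat -> R) n : nat -> R := fun k => if (k < n)%N then a k else 0.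

Definition unit_seq i : nat -> R := fun k => (k == i)%:R.

Lemma l1_truncate a n : l1 (truncate a n) /\
  l1norm (truncate a n) = \sum_(0 <= i < n) `|a i|.
Proof.
have [|h ->] := @l1_finite n (truncate a n).
  by move=> i ni; rewrite /truncate ltnNge ni.
split=> //; apply: eq_big_nat => i /andP[_ ni].
by rewrite /truncate ni.
Qed.

Lemma l1_unit_seq i : l1 (unit_seq i) /\ l1norm (unit_seq i) = 1.
Proof.
have [|h ->] := @l1_finite i.+1 (unit_seq i).
  by move=> j ij; rewrite /unit_seq gtn_eqF.
split=> //; rewrite big_nat_recr//= /unit_seq eqxx normr1 big_nat_cond big1 ?add0r//.
by move=> j /andP[/andP[_ ji] _]; rewrite ltn_eqF// normr0.
Qed.

(** The factor 1 gives the exact form in which linearity of the embedding is assumed. *)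
Lemma truncateS a n :
  truncate a n.+1 = fun k => 1 * truncate a n k + a n * unit_seq n k.
Proof.
apply/funext => k; rewrite /truncate /unit_seq ltnS leq_eqVlt.
by have [->|kn] := eqVneq k n; rewrite ?ltnn ?mulr1 ?mulr0 ?add0r ?addr0 ?mul1r.
Qed.

End FinitelySupportedSequences.

(** * From the completion back to finitely supported functions *)

Section Completion.
Context {G : choiceType} {R : realType} {S : set (set G)}.
Implicit Types (u v : nat -> G -> R) (phi psi : G -> R).

Lemma jnorm_triangle {phi psi} : fin_supp phi -> fin_supp psi ->
  jnorm S (phi + psi) <= jnorm S phi + jnorm S psi.
Proof.
move=> fphi fpsi; have := jnorm_comb S 1 1 fphi fpsi.
by rewrite !scale1r normr1 !mul1r.
Qed.

Lemma fin_suppB {phi psi} : fin_supp phi -> fin_supp psi -> fin_supp (phi - psi).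
Proof.
by move=> fphi fpsi; rewrite -[phi]scale1r -scaleN1r; exact: fin_supp_comb.
Qed.

Lemma jnorm_le_dist {phi psi} : fin_supp phi -> fin_supp psi ->
  jnorm S phi <= jnorm S psi + jnorm S (phi - psi).
Proof.
move=> fphi fpsi; have := jnorm_triangle fpsi (fin_suppB fphi fpsi).
by rewrite addrC subrK.
Qed.

(** By the reverse triangle inequality the norms form a Cauchy sequence, so the [limn] in [JS_norm]
    is a genuine limit. *)
Lemma JS_norm_cvg u : JS_elem S u -> (fun n => jnorm S (u n)) @ \oo --> JS_norm S u.
Proof.
move=> [fu cu].
suff : cauchy_ex ((fun n => jnorm S (u n)) @ \oo) by move=> /cauchy_exP/cauchy_cvg.
move=> e e0; have [N hN] := cu e e0; exists (jnorm S (u N)); exists N => // n /= Nn.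
rewrite /ball /= ltr_norml.
have h1 : jnorm S (u N - u n) < e by exact: hN.
have h2 : jnorm S (u n - u N) < e by exact: hN.
have := jnorm_le_dist (fu n) (fu N); have := jnorm_le_dist (fu N) (fu n).
lra.
Qed.

Lemma JS_equiv_near {u v} : JS_equiv S u v ->
  forall e : R, 0 < e -> exists N, forall m, (N <= m)%N -> jnorm S (u m - v m) < e.
Proof.
move=> /cvgr0Pnorm_lt uv e e0; have [N _ hN] := uv e e0.
by exists N => m Nm; have := hN m Nm; rewrite /= ger0_norm ?jnorm_ge0.
Qed.

Context {T : (nat -> R) -> (nat -> G -> R)}.
Hypothesis TJS : forall a, l1 a -> JS_elem S (T a).
Hypothesis Tlin : forall (a b : nat -> R) (c d : R), l1 a -> l1 b ->
  JS_equiv S (T (fun k => c * a k + d * b k)) (fun n x => c * T a n x + d * T b n x).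

(** [T] is linear only up to equivalence of representing sequences, so the expansion over unit
    vectors holds approximately at late terms; each coordinate added costs one use of [Tlin]. *)
Lemma truncate_image (a : nat -> R) n (e : R) : 0 < e -> exists N, forall m, (N <= m)%N ->
  jnorm S (T (truncate a n) m - \sum_(0 <= i < n) a i *: T (unit_seq i) m) < e.
Proof.
have fT b m : l1 b -> fin_supp (T b m) by move=> /TJS[].
have fW k m : fin_supp (\sum_(0 <= i < k) a i *: T (unit_seq i) m).
  apply: (jnorm_sum S _ a (fun i => T (unit_seq i) m) _).1 => i.
  exact/fT/(l1_unit_seq i).1.
elim: n e => [|n IH] e e0.
  have [l0 _] := l1_truncate a 0.
  (* Linearity with both scalars 0 shows that the image of the zero sequence is equivalent to 0. *)
  have := JS_equiv_near (Tlin _ _ 0 0 l0 l0) e e0.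
  have -> : (fun k => 0 * truncate a 0 k + 0 * truncate a 0 k) = truncate a 0.
    by apply/funext => k; rewrite /truncate ltn0 mulr0 addr0.
  move=> [N hN]; exists N => m Nm; have := hN m Nm; congr (jnorm _ (_ - _) < _).
  by rewrite big_geq//; apply/funext => x; rewrite !mul0r addr0.
have e20 : 0 < e / 2 by rewrite divr_gt0.
have [N hN] := IH _ e20.
have [ln _] := l1_truncate a n; have [lu _] := @l1_unit_seq R n.
have [N' hN'] := JS_equiv_near (Tlin _ _ 1 (a n) ln lu) _ e20.
rewrite -truncateS in hN'.
have [lnS _] := l1_truncate a n.+1.
exists (maxn N N') => m; rewrite geq_max => /andP[Nm N'm].
set w := (fun x => 1 * T (truncate a n) m x + a n * T (unit_seq n) m x).
have wE : w = T (truncate a n) m + a n *: T (unit_seq n) m.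
  by apply/funext => x; rewrite /w mul1r.
have fw : fin_supp w.
  by rewrite wE -[X in X + _]scale1r; apply: fin_supp_comb; exact: fT.
rewrite big_nat_recr//=.
have -> : T (truncate a n.+1) m -
    (\sum_(0 <= i < n) a i *: T (unit_seq i) m + a n *: T (unit_seq n) m) =
  (T (truncate a n.+1) m - w) +
  (T (truncate a n) m - \sum_(0 <= i < n) a i *: T (unit_seq i) m).
  by rewrite wE; apply/funext => x; rewrite !fctE; ring.
apply: (le_lt_trans (jnorm_triangle (fin_suppB (fT _ _ lnS) fw) (fin_suppB (fT _ _ ln) (fW _ _)))).
by have := hN m Nm; have := hN' m N'm; rewrite -/w; lra.
Qed.

End Completion.

(** JS contains no subspace isomorphic to l^1(N): there is no linear map
    T : l^1 -> JS with c ||a||_1 <= ||T a|| <= C ||a||_1. *)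
Theorem theorem2p2 (G : choiceType) (R : realType) (S : set (set G)) :
  [set: G] !=set0 -> countably_intersected S ->
  ~ (exists T : (nat -> R) -> (nat -> G -> R),
       [/\ (forall a, l1 a -> JS_elem S (T a)),
           (forall (a b : nat -> R) (c d : R), l1 a -> l1 b ->
              JS_equiv S (T (fun k => c * a k + d * b k))
                         (fun n x => c * T a n x + d * T b n x))
         & (exists c C : R, [/\ 0 < c, 0 < C &
              forall a, l1 a -> c * l1norm a <= JS_norm S (T a) <= C * l1norm a])]).
Proof.
move=> _ SCI [T [TJS Tlin [c [C [c0 C0 Tc]]]]].
have le i : l1 (unit_seq i : nat -> R) by have [] := @l1_unit_seq R i.
have c20 : 0 < c / 2 by rewrite divr_gt0.
(* Each image of a unit vector is replaced by one late term of its representing sequence, within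
   [c / 2] of all later ones. This perturbation lowers the constant of the l^1 estimate from [c] to
   [c / 2]. *)
have /choice[N hN] : forall i, exists N, jnorm S (T (unit_seq i) N) <= C + 1 /\
    forall m, (N <= m)%N -> jnorm S (T (unit_seq i) m - T (unit_seq i) N) < c / 2.
  move=> i; have [_ cu] := TJS _ (le i).
  have [N1 hN1] := cu _ c20.
  have /cvgrPdist_lt/(_ _ ltr01)[N2 _ hN2] := JS_norm_cvg _ (TJS _ (le i)).
  exists (maxn N1 N2); split.
    have := hN2 (maxn N1 N2) (leq_maxr _ _); rewrite /= ltr_norml.
    by have := Tc _ (le i); rewrite (l1_unit_seq i).2 !mulr1; lra.
  by move=> m; rewrite geq_max => /andP[m1 m2]; apply: hN1; rewrite // leq_maxl.
pose phi i := T (unit_seq i) (N i).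
have fT a m : l1 a -> fin_supp (T a m) by move=> /TJS[].
have fphi i : fin_supp (phi i) by exact: fT.
apply: (no_lower_l1_estimate phi SCI fphi (fun i => (hN i).1) _ c20) => n a.
set r := \sum_(0 <= i < n) `|a i|; set w := \sum_(0 <= i < n) a i *: phi i.
have [la lr] := l1_truncate a n.
apply/ler_addgt0Pl => e e0; have e20 : 0 < e / 2 by rewrite divr_gt0.
have [N1 hN1] := truncate_image TJS Tlin a n _ e20.
have /cvgrPdist_lt/(_ _ e20)[N2 _ hN2] := JS_norm_cvg _ (TJS _ la).
pose m := maxn (\max_(i < n) N i) (maxn N1 N2).
have := hN2 m _; rewrite /= ltr_norml => /(_ _)h2.
have {}h2 := h2 (leq_trans (leq_maxr _ _) (leq_maxr _ _)).
have {}hN1 := hN1 m (leq_trans (leq_maxl _ _) (leq_maxr _ _)).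
set W := \sum_(0 <= i < n) _ in hN1.
have [fW _] := jnorm_sum S (index_iota 0 n) a (fun i => T (unit_seq i) m) (fun i => fT _ _ (le i)).
have [fw _] := jnorm_sum S (index_iota 0 n) a phi fphi.
have h3 := jnorm_le_dist (S := S) (fT _ m la) fW.
have h4 := jnorm_le_dist (S := S) fW fw.
have h5 : jnorm S (W - w) <= r * (c / 2).
  (* For [i < n] the maximum equals [m]; written this way, the index is at least [N i] for every
     [i]. *)
  have -> : W - w = \sum_(0 <= i < n) truncate a n i *: (T (unit_seq i) (maxn m (N i)) - phi i).
    rewrite -sumrB; apply: eq_big_nat => i /andP[_ ni].
    have Nm : (N i <= m)%N.
      apply: leq_trans (leq_maxl _ _).
      exact: (@leq_bigmax 'I_n (fun i => N i) (Ordinal ni)).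
    by rewrite /truncate ni (maxn_idPl Nm) scalerBr.
  have [_] := jnorm_sum S (index_iota 0 n) (truncate a n)
    (fun i => T (unit_seq i) (maxn m (N i)) - phi i) (fun i => fin_suppB (fT _ _ (le i)) (fphi i)).
  move=> /le_trans; apply; rewrite /r mulr_suml big_nat_cond [leRHS]big_nat_cond.
  apply: ler_sum => i /andP[/andP[_ ni] _]; rewrite /truncate ni ler_wpM2l//.
  by apply/ltW/(hN i).2; rewrite leq_maxr.
(* [c * r] is at most the norm of [T (truncate a n)], which exceeds that of [W] by at most [e];
   passing from [W] to [w] costs [r * (c / 2)]. *)
have := Tc _ la; rewrite lr -/r.
by lra.
Qed.
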